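(* Let $S_{1,n-3}$ be the tree with vertices $v_0,v_1,\dots,v_{n-1}$ and edges $e_1=\{v_0,v_1\}$, $e_2=\{v_1,v_2\}$, $e_i=\{v_2,v_i\}$ for $3\le i\le n-1$. Let $B_1=\{e_1,\dots,e_{n-1},f_1,f_2\}$ with $f_1=\{v_0,v_2\}$, $f_2=\{v_1,v_3\}$, and $B_2=\{e_1,\dots,e_{n-1},f_1,f_2\}$ with $f_1=\{v_0,v_2\}$, $f_2=\{v_3,v_4\}$. Then: (1) the eigenvalues of $\mathfrak{D}_2(S_{1,n-3})[B_1,B_1]$ are $-1$ with multiplicity $n-5$ and the roots of $h_1(x)=x^6-2(n-1)x^5-3(7n-12)x^4-18(3n-7)x^3-5(9n-22)x^2-(13n-28)x-(n-1)$; (2) the eigenvalues of $\mathfrak{D}_2(S_{1,n-3})[B_2,B_2]$ are $-1$ with multiplicity $n-5$ and the roots of $h_2(x)=x^6-2(n-1)x^5-(21n-22)x^4-(62n-141)x^3-(53n-133)x^2-(15n-34)x-(n-1)$.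
   Context: For a tree $T$, let $\mathcal{V}_2$ be the set of 2-element vertex subsets (edges regarded as elements of $\mathcal{V}_2$). The 2-Steiner distance matrix $\mathfrak{D}_2(T)$ is indexed by $\mathcal{V}_2$, with entry in row $\{i,j\}$, column $\{k,l\}$ equal to the minimum number of edges of a connected subtree of $T$ whose vertex set contains $i,j,k,l$. $M[B,B]$ denotes the principal submatrix with rows and columns indexed by $B$. *)

(* Defs.v *)
From HB Require Import structures.
From mathcomp Require Import all_boot all_order all_algebra.
Set Implicit Arguments. Unset Strict Implicit. Unset Printing Implicit Defensive.
Import Order.TTheory GRing.Theory Num.Theory.

(* Graphs on a finite vertex type V: edges are 2-element vertex subsets. *)

Definition conn_subgraph_containing (V : finType) (E : {set {set V}})
    (S W : {set V}) (F : {set {set V}}) : bool :=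
  [&& F \subset E, [forall f in F, f \subset W], S \subset W &
      [forall x in W, forall y in W,
         connect (fun a b : V => [set a; b] \in F) x y]].

(* Steiner distance of S in the graph E: minimum number of edges of a connected
   subgraph whose vertex set contains S.  (For a tree, (setT, E) is feasible, so
   the default value #|E| of the minimum is never smaller than the true min.) *)
Definition steiner_dist (V : finType) (E : {set {set V}}) (S : {set V}) : nat :=
  \big[minn/#|E|]_(W : {set V})
    \big[minn/#|E|]_(F : {set {set V}} | conn_subgraph_containing E S W F) #|F|.

Definition steiner2_submx (R : nzRingType) (V : finType) (E : {set {set V}})
    (m : nat) (b : 'I_m -> {set V}) : 'M[R]_m :=
  \matrix_(p, q) ((steiner_dist E (b p :|: b q))%:R)%R.

Definition vpair (n a c : nat) : {set 'I_n} :=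
  [set x : 'I_n | (val x == a) || (val x == c)].

Definition sedge (n i : nat) : {set 'I_n} :=
  if i == 1 then vpair n 0 1 else if i == 2 then vpair n 1 2 else vpair n 2 i.

Definition S1_edges (n : nat) : {set {set 'I_n}} :=
  [set sedge n (val i) | i : 'I_n & 0 < val i].

Definition Bfam (n : nat) (f1 f2 : {set 'I_n}) (k : 'I_n.+1) : {set 'I_n} :=
  if val k < n.-1 then sedge n (val k).+1 else if val k == n.-1 then f1 else f2.

Definition B1 (n : nat) := @Bfam n (vpair n 0 2) (vpair n 1 3).
Definition B2 (n : nat) := @Bfam n (vpair n 0 2) (vpair n 3 4).

Local Open Scope ring_scope.

Definition h1 (R : nzRingType) (n : nat) : {poly R} :=
  let N := (n%:R : R) in
  'X^6 - (2 * (N - 1))%:P * 'X^5 - (3 * (7 * N - 12))%:P * 'X^4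
  - (18 * (3 * N - 7))%:P * 'X^3 - (5 * (9 * N - 22))%:P * 'X^2
  - (13 * N - 28)%:P * 'X - (N - 1)%:P.

Definition h2 (R : nzRingType) (n : nat) : {poly R} :=
  let N := (n%:R : R) in
  'X^6 - (2 * (N - 1))%:P * 'X^5 - (21 * N - 22)%:P * 'X^4
  - (62 * N - 141)%:P * 'X^3 - (53 * N - 133)%:P * 'X^2
  - (15 * N - 34)%:P * 'X - (N - 1)%:P.

Arguments B1 n : clear implicits.
Arguments B2 n : clear implicits.
Arguments S1_edges n : clear implicits.
Arguments h1 R n : clear implicits.
Arguments h2 R n : clear implicits.

(* Main.v *)
Require Import Defs.
From HB Require Import structures.
From mathcomp Require Import all_boot all_order all_algebra.
From mathcomp Require Import zify ring.
Import Order.TTheory GRing.Theory Num.Theory.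

(** An edge of a tree lies on the subtree spanned by S exactly when S meets both of its
    sides, so every entry of the two matrices is an explicit count. The leaf edges
    e_5, ..., e_(n-1) are interchangeable, and the matrix is, up to a correction of the
    diagonal, constant on the blocks given by seven classes of pairs. Sylvester's identity
    det(1 - AB) = det(1 - BA) therefore turns the characteristic polynomial, evaluated at
    x > 0, into (x+1)^(n-6) times a 7 x 7 determinant, which equals (x+1) h(x). *)

(** * Finite minima, crossing edges and the branches of the tree *)

Lemma leq_bigminn (I : finType) (P : pred I) (F : I -> nat) (d k : nat) :
  k <= d -> (forall i, P i -> k <= F i) -> k <= \big[minn/d]_(i | P i) F i.
Proof.
move=> kd kF; apply: (big_ind (fun x => k <= x)) => // x y kx ky.
by rewrite leq_min kx ky.
Qed.

Lemma bigminn_leq (I : finType) (P : pred I) (F : I -> nat) (d : nat) (i : I) :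
  P i -> \big[minn/d]_(j | P j) F j <= F i.
Proof.
move=> Pi; have: i \in index_enum I by rewrite mem_index_enum.
elim: (index_enum I) => [//|j s IHs]; rewrite inE big_cons.
case/orP => [/eqP <-|/IHs le_s]; first by rewrite Pi geq_minl.
by case: ifP => // _; exact: leq_trans (geq_minr _ _) le_s.
Qed.

Lemma connect_crossing (T : finType) (e : rel T) (A : pred T) (x y : T) :
  connect e x y -> A x -> ~~ A y -> exists a b, [/\ e a b, A a & ~~ A b].
Proof.
case/connectP => p + ->; elim: p x => [|z p IHp] x /=.
  by move=> _ ->.
case/andP => exz pz Ax nAy.
by have [Az|nAz] := boolP (A z); [exact: IHp pz Az nAy | exists x, z].
Qed.

(* The side of [sedge n i] that does not contain the vertex 2. *)
Definition branch (i y : nat) : bool :=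
  if i == 1 then y == 0 else if i == 2 then y < 2 else y == i.

(** The guard [2 < i] discards i = 0, which indexes no edge. *)
Definition meets_branch (P : pred nat) (i : nat) : bool :=
  if i == 1 then P 0 else if i == 2 then P 0 || P 1 else (2 < i) && P i.

Lemma sedge_crossing (n i j : nat) (a b : 'I_n) :
  0 < i -> 0 < j -> sedge n j = [set a; b] -> branch i a -> ~~ branch i b -> j = i.
Proof.
move=> i0 j0 Ej; have := set21 a b; have := set22 a b; rewrite -Ej.
rewrite /sedge /branch /vpair.
by case: ifP => [?|j1]; [|case: ifP => [?|j2]];
 (case: ifP => [?|i1]; [|case: ifP => [?|i2]]); rewrite !inE /=; lia.
Qed.

Lemma sedge_inj (n i j : nat) : 2 < n -> 0 < i < n -> 0 < j < n ->
  sedge n i = sedge n j -> i = j.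
Proof.
move=> n2 /andP[i0 ni] /andP[j0 nj] /setP E.
(* Two distinct edges are told apart by one of the vertices i, j, 2 and 1. *)
have := E (Ordinal ni); have := E (Ordinal nj).
have := E (Ordinal n2); have := E (@Ordinal n 1 (ltnW n2)).
rewrite /sedge /vpair.
by case: ifP => [?|j1]; [|case: ifP => [?|j2]];
 (case: ifP => [?|i1]; [|case: ifP => [?|i2]]); rewrite !inE /=; lia.
Qed.

(** * Steiner distance as a count of edges *)

Section SteinerDistance.

Variables (n : nat) (P : pred nat).
Hypothesis hn : 4 < n.

(** [W] and [F] are the vertices and edges of the subtree spanned by S and the vertex 2; the path
    from 0 to 2 brings in 1. *)
Let S : {set 'I_n} := [set x : 'I_n | P x].
Let F : {set {set 'I_n}} := [set sedge n i | i : 'I_n & meets_branch P i].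
Let W : {set 'I_n} := [set x : 'I_n | [|| x == 2 :> nat, P x | (x == 1 :> nat) && P 0]].

Lemma meets_branch_gt0 i : meets_branch P i -> 0 < i.
Proof. by rewrite /meets_branch; case: i. Qed.

Lemma card_hull_edges : #|F| = \sum_(i < n) meets_branch P i.
Proof.
rewrite card_in_imset.
  by rewrite -sum1_card big_mkcond; apply: eq_bigr => i _; rewrite inE; case: ifP.
move=> i j; rewrite !inE => /meets_branch_gt0 i0 /meets_branch_gt0 j0 /sedge_inj E.
by apply: val_inj; apply: E; rewrite ?i0 ?j0 ?ltn_ord // (ltn_trans _ hn).
Qed.

Lemma hull_feasible : conn_subgraph_containing (S1_edges n) S W F.
Proof.
pose v2 : 'I_n := Ordinal (ltn_trans (isT : 2 < 4) hn).
pose v1 : 'I_n := Ordinal (ltn_trans (isT : 1 < 4) hn).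
pose e := (fun a b : 'I_n => [set a; b] \in F).
have e_sym : connect_sym e.
  by apply: sym_connect_sym => a b; rewrite /e setUC.
apply/and4P; split.
- apply/subsetP => f /imsetP[i + ->]; rewrite inE => /meets_branch_gt0 i0.
  by apply/imsetP; exists i; rewrite ?inE.
- apply/forall_inP => f /imsetP[i + ->]; rewrite inE => ci.
  apply/subsetP => y; move: ci; rewrite !inE /meets_branch /sedge /vpair.
  case: ifP => [_|i1].
    by rewrite !inE => P0 /orP[]/eqP->; rewrite P0 ?orbT.
  case: ifP => [_|i2].
    by rewrite !inE => + /orP[]/eqP-> /=; rewrite // => /orP[]->; rewrite ?orbT.
  by rewrite !inE => /andP[_ Pi] /orP[]/eqP-> //=; rewrite Pi orbT.
- by apply/subsetP => x; rewrite !inE => ->; rewrite orbT.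
have eF (i : 'I_n) (a b : 'I_n) : meets_branch P i -> sedge n i = [set a; b] -> e a b.
  by move=> ci E; apply/imsetP; exists i; rewrite ?inE.
have vpE (a b : 'I_n) : vpair n a b = [set a; b].
  by apply/setP => y; rewrite !inE.
have c1 : P 0 || P 1 -> connect e v1 v2.
  move=> P01; apply/connect1/(eF v2) => //.
  by rewrite /sedge /= -vpE.
(* Paths to 2 suffice: any two vertices of [W] are then joined through 2. *)
have cW x : x \in W -> connect e x v2.
  rewrite !inE => /or3P[/eqP x2|Px|/andP[/eqP x1 P0]].
  - by rewrite (_ : x = v2) ?connect0 //; apply: val_inj.
  - have [x0|x0] := eqVneq (x : nat) 0.
      rewrite x0 in Px; apply: (connect_trans _ (c1 _)); last by rewrite Px.
      apply/connect1/(eF v1) => //.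
      by rewrite /sedge /= -vpE x0.
    have [x1|x1] := eqVneq (x : nat) 1.
      by rewrite (_ : x = v1); [apply: c1; rewrite -x1 Px orbT | apply: val_inj].
    have [x2|x2] := eqVneq (x : nat) 2.
      by rewrite (_ : x = v2) ?connect0 //; apply: val_inj.
    rewrite e_sym; apply/connect1/(eF x).
      by rewrite /meets_branch (negPf x1) (negPf x2) Px andbT; lia.
    by rewrite /sedge (negPf x1) (negPf x2) -vpE.
  by rewrite (_ : x = v1); [apply: c1; rewrite P0 | apply: val_inj].
apply/forall_inP => x /cW cx; apply/forall_inP => y /cW cy.
by apply: connect_trans cx _; rewrite e_sym.
Qed.

(* The hypothesis says that 2 lies on the subtree spanned by S, so that an edge
   belongs to this subtree as soon as S meets its branch. *)
Lemma steiner_dist_S1 : P 2 || (P 3 && (P 1 || P 4)) ->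
  steiner_dist (S1_edges n) S = \sum_(i < n) meets_branch P i.
Proof.
move=> hP; rewrite -card_hull_edges; apply/eqP; rewrite eqn_leq; apply/andP; split.
  apply: leq_trans (bigminn_leq _ _ _ _ W isT) _.
  exact: bigminn_leq hull_feasible.
have sFE : F \subset S1_edges n by case/and4P: hull_feasible.
(* The bound must also hold for the default value of each minimum, the total number of edges; it
   does since [F] consists of edges of the tree. *)
apply: leq_bigminn => [|W' _]; first exact: subset_leq_card.
apply: leq_bigminn => [|F' /and4P[sF'E _ sSW' conn]]; first exact: subset_leq_card.
apply: subset_leq_card; apply/subsetP => f /imsetP[i + ->{f}]; rewrite inE => ci.
have i0 := meets_branch_gt0 _ ci.
have [x Px bx] : exists2 x : 'I_n, P x & branch i x.
  move: ci; rewrite /meets_branch /branch.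
  case: ifP => [_ P0|_]; first by exists (Ordinal (ltn_trans (isT : 0 < 4) hn)).
  case: ifP => [_ /orP[P0|P1]|_ /andP[_ Pi]]; last by exists i.
    by exists (Ordinal (ltn_trans (isT : 0 < 4) hn)).
  by exists (Ordinal (ltn_trans (isT : 1 < 4) hn)).
have [y Py by_] : exists2 y : 'I_n, P y & ~~ branch i y.
  have [P2|nP2] := boolP (P 2).
    exists (Ordinal (ltn_trans (isT : 2 < 4) hn)) => //=.
    by move: ci; rewrite /meets_branch /branch; do 2!case: ifP => //; lia.
  (* Only the branch of e_3 contains 3, and it avoids 1 and 4; for every other edge, 3 itself lies
     outside the branch. *)
  move: hP; rewrite (negPf nP2) /= => /andP[P3 P14].
  have [i3|i3] := eqVneq (i : nat) 3.
    case/orP: P14 => [P1|P4].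
      by exists (Ordinal (ltn_trans (isT : 1 < 4) hn)) => //=; rewrite i3.
    by exists (Ordinal hn) => //=; rewrite i3.
  exists (Ordinal (ltn_trans (isT : 3 < 4) hn)) => //=.
  by rewrite /branch; do 2!case: ifP => //; lia.
have xW : x \in W' by apply: (subsetP sSW'); rewrite inE.
have yW : y \in W' by apply: (subsetP sSW'); rewrite inE.
move/forall_inP/(_ x xW)/forall_inP/(_ y yW): conn => cxy.
(* A path in F' from x to y leaves the branch of e_i, and e_i is the only edge that does so; hence
   e_i is in F'. *)
have [a [b [abF ba bb]]] := connect_crossing _ _ (fun z : 'I_n => branch i z) _ _ cxy bx by_.
have /imsetP[j + Ej] := subsetP sF'E _ abF; rewrite inE => j0.
by rewrite -(sedge_crossing n i j a b i0 j0 (esym Ej) ba bb) -Ej.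
Qed.

End SteinerDistance.

(** Serves the entry of e_1 = {0,1} with itself, the only one whose spanned subtree misses 2. *)
Lemma steiner_dist_edge (V : finType) (E : {set {set V}}) (a b : V) :
  a != b -> [set a; b] \in E -> steiner_dist E [set a; b] = 1.
Proof.
move=> ab abE; apply/eqP; rewrite eqn_leq; apply/andP; split.
  rewrite -(cards1 [set a; b]).
  apply: leq_trans (bigminn_leq _ _ _ _ [set a; b] isT) _.
  apply: bigminn_leq; apply/and4P; split=> //.
  - by rewrite sub1set.
  - by apply/forall_inP => f; rewrite inE => /eqP->.
  apply/forall_inP => x + ; rewrite !inE => xab.
  apply/forall_inP => y + ; rewrite !inE => yab.
  case/orP: xab => /eqP->; case/orP: yab => /eqP->; rewrite ?connect0 //;
    by apply: connect1; rewrite inE // setUC.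
have E0 : 0 < #|E| by apply/card_gt0P; exists [set a; b].
apply: leq_bigminn => // W _; apply: leq_bigminn => // F /and4P[_ _ sW conn].
have aW : a \in W by apply: (subsetP sW); rewrite set21.
have bW : b \in W by apply: (subsetP sW); rewrite set22.
move/forall_inP/(_ a aW)/forall_inP/(_ b bW): conn => cab.
have ba : b != a by rewrite eq_sym.
have [x [y [xyF _ _]]] := connect_crossing _ _ (pred1 a) _ _ cab (eqxx a) ba.
by apply/card_gt0P; exists [set x; y].
Qed.

(** Vertex 0 uses e_1 and e_2, vertex 1 uses e_2, and each distinct leaf above 2 uses its own edge,
    hence [undup]. *)
Lemma sum_meets_branch (n : nat) (s : seq nat) : 4 < n -> all (fun i => i < n) s ->
  \sum_(i < n) meets_branch (mem s) i =
    (0 \in s) + ((0 \in s) || (1 \in s)) + size (undup [seq i <- s | 2 < i]).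
Proof.
move=> hn sn; rewrite -(big_mkord xpredT (fun i => meets_branch (mem s) i : nat)).
rewrite (@big_cat_nat _ _ _ 3) //=; last by lia.
rewrite !big_nat_recl // big_geq //= !addn0; congr (_ + _).
rewrite -[RHS](@perm_size _ [seq i <- index_iota 3 n | i \in s]).
  rewrite size_filter -sumn_count big_seq_cond.
  rewrite (eq_bigr (fun i : nat => (i \in s : nat))); first by rewrite -big_seq_cond sumnE big_map.
  move=> i /andP[]; rewrite mem_index_iota => /andP[i3 _] _.
  by rewrite /meets_branch; case: i i3 => [|[|[|i]]].
apply: uniq_perm; rewrite ?filter_uniq ?iota_uniq ?undup_uniq // => i.
rewrite mem_undup !mem_filter mem_index_iota.
by case: (boolP (i \in s)) => [/(allP sn) ->|]; rewrite ?andbT ?andbF.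
Qed.

(** * Matrix entries by class *)

Lemma vpair_ends (n a b : nat) : vpair n a b = [set x : 'I_n | val x \in [:: a; b]].
Proof. by apply/setP => x; rewrite !inE. Qed.

(* The members of [Bfam] fall into seven classes: e_1, ..., e_4, f_1, f_2, and the
   remaining leaf edges e_5, ..., e_(n-1), which form class 6. *)
Definition class_of (n k : nat) : nat :=
  if k < 4 then k else if k < n.-1 then 6 else if k == n.-1 then 4 else 5.

(** [f] holds the ends of f_2. Only class 6 depends on k, with [k.+1] because position k carries
    e_(k+1). *)
Definition ends (f : nat * nat) (c k : nat) : seq nat :=
  nth [::] [:: [:: 0; 1]; [:: 1; 2]; [:: 2; 3]; [:: 2; 4]; [:: 0; 2];
            [:: f.1; f.2]; [:: 2; k.+1]] c.

Lemma Bfam_ends (n a b : nat) (k : 'I_n.+1) : 4 < n ->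
  Bfam (vpair n 0 2) (vpair n a b) k =
    [set x : 'I_n | val x \in ends (a, b) (class_of n k) k].
Proof.
move=> hn; rewrite /Bfam /class_of /sedge !vpair_ends.
have [k4|k4] := ltnP k 4.
  have -> : val k < n.-1 by rewrite /=; lia.
  by move: k4; rewrite /=; case: (nat_of_ord k) => [|[|[|[|j]]]].
rewrite /=; case: ifP => [_|k1]; last by case: ifP.
have [-> ->] : (k.+1 == 1 = false) * (k.+1 == 2 = false) by split; lia.
by [].
Qed.

(* [true] stands for B_1 and [false] for B_2; [class_dist b i j] is the Steiner
   distance of distinct members of the classes i and j, and of a member with itself
   if i = j < 6. *)
Definition f2_ends (b : bool) : nat * nat := if b then (1, 3) else (3, 4).

Definition class_dist (b : bool) (i j : nat) : nat :=
  nth 0 (nth [::] (if b then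
    [:: [:: 1; 2; 3; 3; 2; 3; 3]; [:: 2; 1; 2; 2; 2; 2; 2];
        [:: 3; 2; 1; 2; 3; 2; 2]; [:: 3; 2; 2; 1; 3; 3; 2]; [:: 2; 2; 3; 3; 2; 3; 3];
        [:: 3; 2; 2; 3; 3; 2; 3]; [:: 3; 2; 2; 2; 3; 3; 2]]
  else
    [:: [:: 1; 2; 3; 3; 2; 4; 3]; [:: 2; 1; 2; 2; 2; 3; 2];
        [:: 3; 2; 1; 2; 3; 2; 2]; [:: 3; 2; 2; 1; 3; 2; 2]; [:: 2; 2; 3; 3; 2; 4; 3];
        [:: 4; 3; 2; 2; 4; 2; 3]; [:: 3; 2; 2; 2; 3; 3; 2]]) i) j.

Lemma class_of_lt7 (n k : nat) : class_of n k < 7.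
Proof. by rewrite /class_of; do 3?case: ifP => //; lia. Qed.

(** Only class 6 can have several members. Its table entry 2 is for distinct leaf edges; the added
    Boolean makes up for the distance 1 of such an edge to itself. *)
Lemma steiner_dist_ends (n : nat) (b : bool) (c c' k k' : nat) : 4 < n ->
  c < 7 -> c' < 7 -> (c == 6 -> 3 < k < n.-1) -> (c' == 6 -> 3 < k' < n.-1) ->
  steiner_dist (S1_edges n) ([set x : 'I_n | val x \in ends (f2_ends b) c k]
      :|: [set x : 'I_n | val x \in ends (f2_ends b) c' k'])
    + [&& c == 6, c' == 6 & k == k'] = class_dist b c c'.
Proof.
move=> hn c7 c'7 hk hk'.
have [/andP[/eqP-> /eqP->]|cc] := boolP ((c == 0) && (c' == 0)).
  have n1 : 1 < n by lia.
  pose v0 : 'I_n := Ordinal (ltnW n1); pose v1 : 'I_n := Ordinal n1.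
  rewrite /= setUid (_ : [set _ | _] = [set v0; v1]); last first.
    by apply/setP => x; rewrite !inE.
  rewrite steiner_dist_edge //; first by case: b.
  by apply/imsetP; exists v1; rewrite ?inE //; apply/setP => x; rewrite !inE.
have -> : [set x : 'I_n | val x \in ends (f2_ends b) c k]
      :|: [set x : 'I_n | val x \in ends (f2_ends b) c' k'] =
   [set x : 'I_n | mem (ends (f2_ends b) c k ++ ends (f2_ends b) c' k') x].
  by apply/setP => x; rewrite !inE mem_cat.
rewrite steiner_dist_S1 // ?sum_meets_branch //.
all: case: c c7 cc hk => [|[|[|[|[|[|[|//]]]]]]] _ cc hk.
all: case: c' c'7 cc hk' => [|[|[|[|[|[|[|//]]]]]]] _ //= _ hk'.
all: case: b => //=.
all: rewrite ?inE ?orbT ?andbT //=; try by lia.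
all: repeat (case: ifP; rewrite ?inE /=); rewrite /class_dist /=; by lia.
Qed.

Lemma class_of_leaf (n k : nat) : class_of n k == 6 -> 3 < k < n.-1.
Proof. by rewrite /class_of; do 3?case: ifP; lia. Qed.

Local Open Scope ring_scope.

(** * Determinant and polynomial identities *)

(** The same unitriangular factor, applied to [M] on the right or on the left, clears the lower left
    block, so both sides equal the determinant of [M]. *)
Lemma det_sub_mulmxC (R : comNzRingType) (m n : nat) (A : 'M[R]_(m, n)) (B : 'M[R]_(n, m)) :
  \det (1%:M - A *m B) = \det (1%:M - B *m A).
Proof.
pose M := block_mx 1%:M A B 1%:M.
have E1 : M *m block_mx 1%:M 0 (- B) 1%:M = block_mx (1%:M - A *m B) A 0 1%:M.
  by rewrite mulmx_block !mulmx1 !mul1mx !mulmx0 mulmxN subrr !add0r.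
have E2 : block_mx 1%:M 0 (- B) 1%:M *m M = block_mx 1%:M A 0 (1%:M - B *m A).
  by rewrite mulmx_block !mul1mx !mul0mx !addr0 mulmx1 mulNmx addNr addrC.
have D : \det (block_mx 1%:M 0 (- B) 1%:M) = 1.
  by rewrite det_lblock !det1 mulr1.
move/(congr1 determinant): E1; rewrite det_mulmx D mulr1 det_ublock det1 mulr1 => <-.
by move/(congr1 determinant): E2; rewrite det_mulmx D mul1r det_ublock det1 mul1r => ->.
Qed.

(* Sylvester's identity det(1 - AB) = det(1 - BA) for the incidence matrix of t
   collapses each class of indices to a single row. *)
Lemma det_quotient (K : fieldType) (N k : nat) (t : 'I_N -> 'I_k) (d : 'I_k -> K)
    (D : 'I_k -> 'I_k -> K) : (forall j, d j != 0) ->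
  \det (\matrix_(p, q) ((p == q)%:R * d (t p) - D (t p) (t q))) * \prod_j d j =
  (\prod_p d (t p)) *
    \det (\matrix_(i, j) ((i == j)%:R * d j - D i j * (\sum_p (t p == j))%N%:R)).
Proof.
move=> d0.
pose T : 'M[K]_(N, k) := \matrix_(p, j) (t p == j)%:R.
(* Dividing by [d (t q)] lets the diagonal factor out on the right, leaving 1 - TU and 1 - UT; the
   product UT produces the class sizes. *)
pose U : 'M[K]_(k, N) := \matrix_(j, q) (D j (t q) / d (t q)).
have -> : \matrix_(p, q) ((p == q)%:R * d (t p) - D (t p) (t q)) =
    (1%:M - T *m U) *m diag_mx (\row_p d (t p)).
  apply/matrixP => p q; rewrite mul_mx_diag !mxE.
  rewrite (bigD1 (t p)) //= !mxE eqxx mul1r big1 ?addr0; last first.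
    by move=> j /negPf jp; rewrite !mxE eq_sym jp mul0r.
  by rewrite mulrBl divfK //; case: eqVneq => [->|_]; rewrite ?mul0r.
have -> : \matrix_(i, j) ((i == j)%:R * d j - D i j * (\sum_p (t p == j))%N%:R) =
    (1%:M - U *m T) *m diag_mx (\row_j d j).
  apply/matrixP => i j; rewrite mul_mx_diag !mxE mulrBl; congr (_ - _).
  rewrite natr_sum mulr_sumr mulr_suml; apply: eq_bigr => p _; rewrite !mxE.
  by case: eqVneq => [->|_]; rewrite ?mulr0 ?mul0r // !mulr1 divfK.
rewrite !det_mulmx !det_diag det_sub_mulmxC.
rewrite [\prod_i _ 0 i](eq_bigr (fun p => d (t p))) => [|p _]; last by rewrite mxE.
rewrite [X in _ = _ * (_ * X)](eq_bigr d) => [|p _]; last by rewrite mxE.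
by ring.
Qed.

(** The difference vanishes at 1, 2, 3, ..., distinct in characteristic zero. Positive x keeps x and
    x + 1 invertible. *)
Lemma poly_eq_pos (R : numFieldType) (p q : {poly R}) :
  (forall x : R, 0 < x -> p.[x] = q.[x]) -> p = q.
Proof.
move=> pq; apply/eqP; rewrite -subr_eq0; apply/eqP.
pose s := [seq k.+1%:R : R | k <- iota 0 (size (p - q))].
apply: (@roots_geq_poly_eq0 _ _ s); last by rewrite size_map size_iota.
  by apply/allP => _ /mapP[k _ ->]; rewrite /root !hornerE pq ?subrr ?ltr0Sn.
rewrite map_inj_uniq ?iota_uniq // => i j /eqP.
by rewrite eqr_nat eqSS => /eqP.
Qed.

Lemma horner_char_poly (R : comNzRingType) (n : nat) (A : 'M[R]_n) (x : R) :
  (char_poly A).[x] = \det (x%:M - A).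
Proof.
rewrite -horner_evalE -det_map_mx; congr determinant; apply/matrixP => i j.
by rewrite !mxE /= horner_evalE !hornerE; case: eqP => _; rewrite !hornerE.
Qed.

(** The row operation is multiplication by 1 - uv, of determinant one because vu = 0. *)
Lemma det_sub_last_row (R : comNzRingType) (n : nat) (A : 'M[R]_n.+1) :
  \det (\matrix_(i, j) (A i j - (i != ord_max)%:R * A ord_max j)) = \det A.
Proof.
pose u : 'cV[R]_n.+1 := \col_i (i != ord_max)%:R.
pose v : 'rV[R]_n.+1 := delta_mx 0 ord_max.
rewrite (_ : \matrix_(i, j) _ = (1%:M - u *m v) *m A); last first.
  apply/matrixP => i j; rewrite mulmxBl mul1mx -mulmxA -rowE !mxE; congr (_ - _).
  by rewrite big_ord1 !mxE.
rewrite det_mulmx det_sub_mulmxC -rowE (_ : row _ _ = 0) ?subr0 ?det1 ?mul1r //.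
by apply/matrixP => i j; rewrite !mxE eqxx.
Qed.

(** * Laplace expansion and the 7 x 7 quotient determinant *)

Fixpoint del_nth (T : Type) (j : nat) (s : seq T) {struct s} : seq T :=
  if s is x :: s' then if j is j'.+1 then x :: del_nth T j' s' else s' else [::].

Lemma nth_del_nth (T : Type) (x0 : T) (j k : nat) (s : seq T) :
  nth x0 (del_nth T j s) k = nth x0 s (bump j k).
Proof. by elim: s j k => [|x s IHs] [|j] [|k] //=; rewrite ?nth_nil ?IHs ?bumpS. Qed.

(* [None] encodes a zero entry, whose minor is then never expanded. *)
Fixpoint laplace (R : nzRingType) (n : nat) (M : seq (seq (option R))) : R :=
  if n is n'.+1 then
    foldr (fun j s =>
      if nth None (head [::] M) j is Some a then
        (if odd j then - a else a) * laplace R n' [seq del_nth _ j r | r <- behead M] + s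
      else s) 0 (iota 0 n)
  else 1.

Definition sparse_entry (R : nzRingType) (M : seq (seq (option R))) (i j : nat) : R :=
  odflt 0 (nth None (nth [::] M i) j).

Lemma det_laplace (R : comNzRingType) (n : nat) (M : seq (seq (option R))) :
  \det (\matrix_(i < n, j < n) sparse_entry R M i j) = laplace R n M.
Proof.
elim: n M => [|n IHn] M; first by rewrite det_mx00.
pose G j := laplace R n [seq del_nth _ j r | r <- behead M].
have foldr_sum r : foldr (fun j s => if nth None (head [::] M) j is Some a
      then (if odd j then - a else a) * G j + s else s) 0 r =
    \sum_(j <- r) (-1) ^+ j * sparse_entry R M 0 j * G j.
  elim: r => [|j r IHr]; rewrite ?big_nil ?big_cons //= IHr /sparse_entry nth0.
  case: (nth _ _ j) => [a|] /=; last by rewrite mulr0 mul0r add0r.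
  by rewrite -signr_odd; case: odd; rewrite ?mulN1r ?mul1r.
rewrite [RHS](foldr_sum (iota 0 n.+1)) -[iota 0 n.+1]/(index_iota 0 n.+1).
rewrite big_mkord (expand_det_row _ ord0); apply: eq_bigr => j _.
rewrite mxE /cofactor add0n mulrA [_ * (-1) ^+ _]mulrC; congr (_ * _).
rewrite /G -IHn; congr determinant; apply/matrixP => i k; rewrite !mxE /sparse_entry.
congr odflt; rewrite -nth_del_nth; congr nth.
case: M {G foldr_sum} => [|r M] /=; first by rewrite !nth_nil.
by elim: M (nat_of_ord i) => [|r1 M IHM] [|i1] //=; exact: IHM.
Qed.

(** A class 6 diagonal entry x - 1 is written (x + 1) - 2, to match the table value 2. *)
Definition class_diag (R : nzRingType) (x : R) (j : nat) : R :=
  if j == 6%N then x + 1 else x.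

(** The small matrix of [det_quotient]: [m] stands for the size n - 5 of class 6, the other classes
    being singletons. *)
Definition class_mx (R : nzRingType) (b : bool) (x m : R) (i j : nat) : R :=
  (i == j)%:R * class_diag R x j - (class_dist b i j)%:R * (if j == 6%N then m else 1).

(* [class_mx] after subtraction of the last row from the others. *)
Definition reduced_mx (R : nzRingType) (b : bool) (x m : R) : seq (seq (option R)) :=
  let o : option R := None in let s := Some in
  let y := x + 1 in
  if b then
    [:: [:: s (y + 1); o;   s (-1); s (-1); s 1; o;   s (- y - m)];
        [:: s 1;       s y; o;      o;      s 1; s 1; s (- y)];
        [:: o;         o;   s y;    o;      o;   s 1; s (- y)];
        [:: o;         o;   o;      s y;    o;   o;   s (- y)];
        [:: s 1;       o;   s (-1); s (-1); s y; o;   s (- y - m)];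
        [:: o;         o;   o;      s (-1); o;   s y; s (- y - m)];
        [:: s (-3); s (-2); s (-2); s (-2); s (-3); s (-3); s (y - 2 * m)]]
  else
    [:: [:: s (y + 1); o;   s (-1); s (-1); s 1; s (-1); s (- y - m)];
        [:: s 1;       s y; o;      o;      s 1; o;      s (- y)];
        [:: o;         o;   s y;    o;      o;   s 1;    s (- y)];
        [:: o;         o;   o;      s y;    o;   s 1;    s (- y)];
        [:: s 1;       o;   s (-1); s (-1); s y; s (-1); s (- y - m)];
        [:: s (-1); s (-1); o;      o;   s (-1); s y; s (- y - m)];
        [:: s (-3); s (-2); s (-2); s (-2); s (-3); s (-3); s (y - 2 * m)]].

Lemma laplace_reduced_mx (R : numFieldType) (b : bool) (n : nat) (x : R) :
  laplace R 7 (reduced_mx R b x (n%:R - 5)) = (x + 1) * (if b then h1 R n else h2 R n).[x].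
Proof.
rewrite /h1 /h2; case: b; rewrite !hornerE;
  cbn -[GRing.natmul GRing.add GRing.opp GRing.mul GRing.one].
all: by ring.
Qed.

Lemma det_class_mx (R : numFieldType) (b : bool) (n : nat) (x : R) :
  \det (\matrix_(i < 7, j < 7) class_mx R b x (n%:R - 5) i j) =
    (x + 1) * (if b then h1 R n else h2 R n).[x].
Proof.
rewrite -laplace_reduced_mx -det_laplace -det_sub_last_row; congr determinant.
apply/matrixP => i j; rewrite !mxE -val_eqE /= /sparse_entry /class_mx /class_diag.
case: i j => [i i7] [j j7] /=; move: (n%:R - 5) => m.
case: i i7 => [|[|[|[|[|[|[|//]]]]]]] _; case: j j7 => [|[|[|[|[|[|[|//]]]]]]] _.
all: by rewrite /class_dist /=; case: b => /=; ring.
Qed.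

(** * Class sizes and the characteristic polynomials *)

Lemma sum_class_of (n j : nat) : (4 < n)%N -> (j < 7)%N ->
  (\sum_(p < n.+1) (class_of n p == j) = if j == 6%N then n - 5 else 1)%N.
Proof.
(* From here the tree has n + 1 vertices: positions below 4 carry e_1, ..., e_4, those from 4 to n -
   1 the other leaf edges, and n, n + 1 carry f_1, f_2. *)
case: n => // n hn j7; rewrite -(big_mkord xpredT (fun p => (class_of n.+1 p == j) : nat)).
rewrite (@big_cat_nat _ _ _ 4) //=; last by lia.
rewrite (@big_cat_nat _ _ _ n 4) //=; try by lia.
have -> : (\sum_(4 <= p < n) (class_of n.+1 p == j) = (n - 4) * (6 == j))%N.
  rewrite (eq_big_nat _ _ (F2 := fun=> (6 == j)%N : nat)) ?sum_nat_const_nat //.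
  by move=> p /andP[p4 pn]; rewrite /class_of [(p < 4)%N]ltnNge p4 /= pn.
have -> : (\sum_(n <= p < n.+2) (class_of n.+1 p == j) = (4 == j) + (5 == j))%N.
  rewrite big_nat_recr //= big_nat1 /class_of /= ltnn eqxx.
  by do 4!(case: ifP => ?; first by lia).
rewrite !big_nat_recl // big_geq //= /class_of /=.
by case: j j7 => [|[|[|[|[|[|[|]]]]]]] //= _; lia.
Qed.

Lemma char_poly_steiner2 (R : numFieldType) (n : nat) (b : bool) : (4 < n)%N ->
  char_poly (steiner2_submx R (S1_edges n)
    (Bfam (vpair n 0 2) (vpair n (f2_ends b).1 (f2_ends b).2)))
  = ('X + 1) ^+ (n - 5) * (if b then h1 R n else h2 R n).
Proof.
move=> hn; apply: poly_eq_pos => x x0; rewrite horner_char_poly.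
set A := steiner2_submx _ _ _; pose t (p : 'I_n.+1) : 'I_7 := Ordinal (class_of_lt7 n p).
pose d := class_diag R x.
have d0 j : d j != 0 by rewrite /d /class_diag; case: ifP => _; rewrite gt_eqF ?addr_gt0.
have := det_quotient _ _ _ t (fun j => d j) (fun i j => (class_dist b i j)%:R) (fun j => d0 j).
set M := (X in \det X * _); have -> : x%:M - A = M.
  apply/matrixP => p q; rewrite !mxE !Bfam_ends // -surjective_pairing.
  rewrite -(steiner_dist_ends n b _ _ p q hn (class_of_lt7 n p) (class_of_lt7 n q)
    (class_of_leaf _ _) (class_of_leaf _ _)) natrD /d /class_diag /= -val_eqE /=.
  case: eqVneq => [->|_]; rewrite ?andbF ?mul0r ?addr0 ?mulr0n //.
  rewrite andbT andbb; case: eqP => _; rewrite mul1r mulr1n ?addr0 //.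
  by rewrite opprD addrACA subrr addr0.
set N := (X in _ * \det X).
have -> : N = \matrix_(i < 7, j < 7) class_mx R b x (n%:R - 5) i j.
  apply/matrixP => i j; rewrite !mxE; congr (_ - _ * _).
  by rewrite (sum_class_of n j hn (ltn_ord j)); case: ifP => // _; rewrite natrB.
rewrite det_class_mx.
have -> : \prod_(j < 7) d j = x ^+ 6 * (x + 1) :> R.
  by rewrite !big_ord_recl big_ord0 /d /class_diag /=; ring.
have -> : \prod_p d (t p) = x ^+ 6 * (x + 1) ^+ (n - 5).
  rewrite (partition_big t xpredT) //=.
  rewrite (eq_bigr (fun j : 'I_7 => d j ^+ (if j == 6%N :> nat then n - 5 else 1)%N)).
    by rewrite !big_ord_recl big_ord0 /d /class_diag /=; ring.
  move=> j _; rewrite (eq_bigr (fun=> d j)) => [|p /eqP <- //].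
  rewrite -(sum_class_of n j hn (ltn_ord j)) prodr_const -sum1_card [in LHS]big_mkcond.
  by congr (_ ^+ _); apply: eq_bigr => p _; rewrite -val_eqE /=; case: ifP.
(* The factor x + 1 of the quotient determinant cancels the one contributed by class 6, so the
   exponent n - 5 is right even for n = 5, when that class is empty. *)
move=> E; apply: (mulIf (_ : x ^+ 6 * (x + 1) != 0)).
  by rewrite mulf_neq0 ?expf_neq0 // gt_eqF ?addr_gt0.
by rewrite E hornerM horner_exp hornerD hornerX hornerC; ring.
Qed.

Theorem theorem5p5 (R : numFieldType) (n : nat) (hn : (5 <= n)%N) :
  char_poly (steiner2_submx R (S1_edges n) (B1 n))
    = ('X + 1) ^+ (n - 5) * h1 R n
  /\
  char_poly (steiner2_submx R (S1_edges n) (B2 n))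
    = ('X + 1) ^+ (n - 5) * h2 R n.
Proof.
split; [exact: (char_poly_steiner2 R n true hn) | exact: (char_poly_steiner2 R n false hn)].
Qed.
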